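(* Let $\hat H=\sum_{\bm R\in\Lambda}\hat H_{\bm R}$ be a translation-invariant $\mathrm{U}(1)$-symmetric free-fermion Hamiltonian on the periodic lattice $\Lambda=(\mathbb Z/L)^d$ with $N$ orbitals per unit cell and local terms of range $r$. Let $H_{\bm k}=H^{(+)}_{\bm k}+H^{(-)}_{\bm k}$ be the decomposition of its Bloch Hamiltonian into its positive semidefinite and negative semidefinite parts, and let $\omega^{(-)}_{m\bm k}\le 0$ ($m=1,\dots,N^{(-)}$) be the eigenvalues of $H^{(-)}_{\bm k}$ that are not identically zero on the Brillouin zone. If $\hat H=\sum_{\bm R}\hat H_{\bm R}$ is frustration-free and $\omega^{(-)}_{m\bm k}<0$ for all $m$ and $\bm k$, then the space of occupied one-particle states $\mathcal E_{\mathrm{occ}}$ admits an (over)complete set of compactly supported Wannier-type functions: there is a family of one-particle states, each supported on unit cells within distance $r$ of some $\bm R\in\Lambda$ (the states need be neither orthogonal nor linearly independent), whose linear span is exactly $\mathcal E_{\mathrm{occ}}$.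
   Context: Fermionic modes $\hat c_{\bm R\tau}$, $\bm R\in\Lambda$, $\tau=1,\dots,N$, satisfy the canonical anticommutation relations on Fock space with vacuum $|0\rangle$; $\hat{\bm c}$ is the column vector of all of them. The local terms are $\hat H_{\bm R}=\hat{\bm c}^\dagger h_{\bm R}\hat{\bm c}+C_{\bm R}$ with $h_{\bm R}$ Hermitian, $C_{\bm R}\in\mathbb R$, and $(h_{\bm R})_{\bm R'\tau,\bm R''\tau'}=0$ whenever $|\bm R'-\bm R|>r$ or $|\bm R''-\bm R|>r$, the range $r$ being a finite constant independent of the system size. $\hat H$ commutes with lattice translations. Frustration-free: writing $E_{\bm R}$ for the smallest eigenvalue of $\hat H_{\bm R}$ on Fock space, there is a nonzero vector $|\Phi\rangle$ with $\hat H_{\bm R}|\Phi\rangle=E_{\bm R}|\Phi\rangle$ for all $\bm R$ simultaneously. Bloch Hamiltonian: with $\hat c^\dagger_{\bm R\tau}=\frac1{\sqrt V}\sum_{\bm k}e^{-i\bm k\cdot\bm R}\hat c^\dagger_{\bm k\tau}$, $V=L^d$, $\bm k\in(\tfrac{2\pi}{L}\mathbb Z/2\pi\mathbb Z)^d$, one has $\hat H=\sum_{\bm k}\hat{\bm c}_{\bm k}^\dagger H_{\bm k}\hat{\bm c}_{\bm k}$ up to an additive constant, with $H_{\bm k}$ an $N\times N$ Hermitian matrix. $H^{(+)}_{\bm k}\ge0$ and $H^{(-)}_{\bm k}\le0$ denote its positive and negative parts ($H^{(+)}_{\bm k}H^{(-)}_{\bm k}=0$); the eigenvalues of $H^{(-)}_{\bm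 k}$ are labelled in increasing order at each $\bm k$, so the assumption $\omega^{(-)}_{m\bm k}<0$ says that $H_{\bm k}$ has exactly $N^{(-)}$ strictly negative eigenvalues at every $\bm k$. Occupied space: diagonalizing $\hat H=\sum_{\bm k,n}\epsilon_{n\bm k}\hat\gamma^\dagger_{n\bm k}\hat\gamma_{n\bm k}$ (up to a constant), with $\epsilon_{n\bm k}$ the eigenvalues of $H_{\bm k}$, $\mathcal E_{\mathrm{occ}}$ is the span in the one-particle Hilbert space of all $\hat\gamma^\dagger_{n\bm k}|0\rangle$ with $\epsilon_{n\bm k}<0$. A one-particle state $\sum_{\bm R',\tau}f_{\bm R'\tau}\hat c^\dagger_{\bm R'\tau}|0\rangle$ is supported on the cells $\bm R'$ for which some $f_{\bm R'\tau}\ne0$. *)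

(* Defs.v *)
From HB Require Import structures.
From mathcomp Require Import all_boot all_order all_algebra.
From mathcomp Require Import complex.
From mathcomp Require Import reals trigo.

Set Implicit Arguments.
Unset Strict Implicit.
Unset Printing Implicit Defensive.

Import Order.TTheory GRing.Theory Num.Theory.
Local Open Scope ring_scope.
Local Open Scope sesquilinear_scope.

(* The periodic lattice (Z/L)^d, for 0 < L.  The ordinal type 'I_(L.-1).+1 is *)
(* 'I_L with a manifest successor, so that it carries addition modulo L.      *)
Notation lattice d L := {ffun 'I_d -> 'I_(L.-1).+1}.

(* The momentum k = (2 pi / L) q is represented by q in (Z/L)^d.              *)
Notation momentum d L := {ffun 'I_d -> 'I_(L.-1).+1} (only parsing).

Notation mode d L N := (lattice d L * 'I_N)%type.

Section Lattice.
Variables (R : realType) (d L N : nat).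

(* Euclidean length of the shortest representative of x - y in Z^d. *)
Definition torus_dist (x y : lattice d L) : R :=
  Num.sqrt (\sum_(i < d) (minn ((x - y)%R i) (L - (x - y)%R i))%:R ^+ 2).

Definition shift_mode (a : lattice d L) (j : mode d L N) : mode d L N :=
  (j.1 + a, j.2).

Definition expi (t : R) : R[i] := (cos t +i* sin t)%C.

(* exp (i k.x) *)
Definition plane_wave (k : momentum d L) (x : lattice d L) : R[i] :=
  expi (2%:R * pi / L%:R * \sum_(i < d) (k i)%:R * (x i)%:R).

End Lattice.

(* Fock space over a finite set M of modes, in the occupation number basis:   *)
(* v S is the component of v along |S> = c+_{j1} ... c+_{jm} |0>, where       *)
(* j1, ..., jm are the elements of S in the order of enum M.                  *)
Notation Fock R M := {ffun {set M} -> (R[i])^o}.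

Section FockSpace.
Variables (R : realType) (M : finType).
Implicit Types (i j : M) (S : {set M}) (v : Fock R M).

Definition ket S : Fock R M := [ffun S' : {set M} => (S' == S)%:R].

Definition vac : Fock R M := ket set0.

Definition jw_sign j S : R[i] :=
  (-1) ^+ #|[set i in S | (enum_rank i < enum_rank j)%N]|.

Definition annih_fun j v : Fock R M :=
  [ffun S : {set M} => if j \in S then 0 else jw_sign j S * v (j |: S)].

Definition creat_fun j v : Fock R M :=
  [ffun S : {set M} => if j \in S then jw_sign j S * v (S :\ j) else 0].

Fact annih_fun_is_linear j : linear (annih_fun j).
Proof.
move=> a u v; apply/ffunP => S; rewrite !ffunE.
by case: ifP => _; rewrite ?scaler0 ?addr0 // mulrDr scalerAr.
Qed.
HB.instance Definition _ j :=
  GRing.isLinear.Build _ _ _ _ (annih_fun j) (annih_fun_is_linear j).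

Fact creat_fun_is_linear j : linear (creat_fun j).
Proof.
move=> a u v; apply/ffunP => S; rewrite !ffunE.
by case: ifP => _; rewrite ?scaler0 ?addr0 // mulrDr scalerAr.
Qed.
HB.instance Definition _ j :=
  GRing.isLinear.Build _ _ _ _ (creat_fun j) (creat_fun_is_linear j).

Definition annih j : 'End(Fock R M) := linfun (annih_fun j).
Definition creat j : 'End(Fock R M) := linfun (creat_fun j).

Definition quadratic (h : M -> M -> R[i]) : 'End(Fock R M) :=
  \sum_i \sum_j h i j *: (creat i \o annih j)%VF.

Definition slater (s : M -> M) (t : seq M) : Fock R M :=
  foldr (fun j w => creat (s j) w) vac t.

(* The Fock space operator induced by a relabelling s of the modes:           *)
(* c+_{j1} ... c+_{jm} |0>  |->  c+_{s j1} ... c+_{s jm} |0>.                 *)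
Definition relabel_fun (s : M -> M) v : Fock R M :=
  \sum_(S : {set M}) v S *: slater s (enum S).

Fact relabel_fun_is_linear s : linear (relabel_fun s).
Proof.
move=> a u v; rewrite /relabel_fun scaler_sumr -big_split /=.
by apply: eq_bigr => S _; rewrite !ffunE scalerDl scalerA.
Qed.
HB.instance Definition _ s :=
  GRing.isLinear.Build _ _ _ _ (relabel_fun s) (relabel_fun_is_linear s).

Definition relabel (s : M -> M) : 'End(Fock R M) := linfun (relabel_fun s).

Definition smallest_eigenvalue (A : 'End(Fock R M)) (E : R) : Prop :=
  passmx.leigenvalue A E%:C%C /\
  forall e : R[i], passmx.leigenvalue A e -> E%:C%C <= e.

End FockSpace.
Arguments ket {R M}.
Arguments vac {R M}.
Arguments jw_sign {R M}.
Arguments annih {R M}.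
Arguments creat {R M}.
Arguments slater {R M}.
Arguments relabel {R M}.

(* The canonical anticommutation relations (annih_anticomm, creat_anticomm,   *)
(* annih_creat_anticomm), and the facts that the occupation number basis and  *)
(* the relabelling operators are the intended ones (ket_slater, relabel_vac,  *)
(* relabel_creat).                                                            *)
Section FockFacts.
Variables (R : realType) (M : finType).
Implicit Types (i j : M) (S : {set M}) (v : Fock R M) (s : M -> M).

Lemma annihE j v S :
  annih j v S = if j \in S then 0 else jw_sign j S * v (j |: S).
Proof. by rewrite /annih lfunE /= ffunE. Qed.

Lemma creatE j v S :
  creat j v S = if j \in S then jw_sign j S * v (S :\ j) else 0.
Proof. by rewrite /creat lfunE /= ffunE. Qed.

Lemma jw_signU i j S : j \notin S ->
  jw_sign i (j |: S) = (-1) ^+ (enum_rank j < enum_rank i)%N * jw_sign i S :> R[i].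
Proof.
move=> jS; rewrite /jw_sign -exprD; congr (_ ^+ _).
case: (boolP (enum_rank j < enum_rank i)%N) => [Pj|/negbTE Pj].
  rewrite (_ : [set _ in _ | _] = j |: [set k in S | (enum_rank k < enum_rank i)%N]).
    by rewrite cardsU1 inE (negbTE jS).
  by apply/setP => k; rewrite !inE; case: (eqVneq k j) => [->|] /=; rewrite ?Pj.
by apply: eq_card => k; rewrite !inE; case: (eqVneq k j) => [->|] /=; rewrite ?(negbTE jS) ?Pj.
Qed.

Lemma jw_signD i j S : j \in S ->
  jw_sign i (S :\ j) = (-1) ^+ (enum_rank j < enum_rank i)%N * jw_sign i S :> R[i].
Proof.
move=> jS; rewrite -{2}(setD1K jS) jw_signU ?setD11 // mulrA -exprD addnn.
by rewrite -signr_odd odd_double mul1r.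
Qed.

Lemma jw_sqr i S : jw_sign i S * jw_sign i S = 1 :> R[i].
Proof. by rewrite /jw_sign -exprD addnn -signr_odd odd_double. Qed.

Lemma rank_sign i j : i != j ->
  (-1) ^+ (enum_rank i < enum_rank j)%N = - (-1) ^+ (enum_rank j < enum_rank i)%N :> R[i].
Proof.
move=> ij; have: enum_rank i != enum_rank j by rewrite (inj_eq enum_rank_inj).
by rewrite -(inj_eq val_inj) /=; case: ltngtP => //= _ _; rewrite ?opprK.
Qed.

Lemma anticomm_sign i j (s t u : R[i]) : i != j ->
  s * ((-1) ^+ (enum_rank i < enum_rank j)%N * t * u) +
  t * ((-1) ^+ (enum_rank j < enum_rank i)%N * s * u) = 0.
Proof. by move=> /rank_sign ->; rewrite !mulrA mulrN !mulNr [t * _ * s]mulrAC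
   [t * s]mulrC [s * _ * t]mulrAC addNr. Qed.

Lemma annih_anticomm i j v : annih i (annih j v) + annih j (annih i v) = 0.
Proof.
apply/ffunP => S; rewrite 2!ffunE !annihE !inE.
have [<-|ij] := eqVneq i j; first by rewrite ?eqxx /= !mulr0 !if_same addr0.
rewrite ?[j == i]eq_sym ?(negbTE ij) /=.
case: (boolP (i \in S)) => iS; case: (boolP (j \in S)) => jS; rewrite ?mulr0 ?addr0 //.
by rewrite !jw_signU // setUCA anticomm_sign.
Qed.

Lemma creat_anticomm i j v : creat i (creat j v) + creat j (creat i v) = 0.
Proof.
apply/ffunP => S; rewrite 2!ffunE !creatE !inE.
have [<-|ij] := eqVneq i j; first by rewrite ?eqxx /= !mulr0 !if_same addr0.
rewrite ?[j == i]eq_sym ?ij /=.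
case: (boolP (i \in S)) => iS; case: (boolP (j \in S)) => jS; rewrite ?mulr0 ?addr0 //.
by rewrite !jw_signD // setDDl setUC -setDDl anticomm_sign.
Qed.

Lemma annih_creat_anticomm i j v :
  annih i (creat j v) + creat j (annih i v) = (i == j)%:R *: v.
Proof.
apply/ffunP => S; rewrite [LHS]ffunE [RHS]ffunE !annihE !creatE !annihE !inE.
have [<-|ij] := eqVneq i j.
  rewrite ?eqxx /= scale1r; case: (boolP (i \in S)) => iS.
    by rewrite add0r jw_signD // ltnn mul1r mulrA jw_sqr mul1r setD1K.
  by rewrite addr0 jw_signU // ltnn mul1r mulrA jw_sqr mul1r setU1K.
rewrite ?[j == i]eq_sym ?(negbTE ij) /= scale0r ?andbT ?andTb ?orFb ?orbF.
case: (boolP (i \in S)) => iS; case: (boolP (j \in S)) => jS; rewrite ?mulr0 ?addr0 //.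
rewrite jw_signU // jw_signD //.
have -> : (i |: S) :\ j = i |: S :\ j.
  by apply/setP => k; rewrite !inE; case: (eqVneq k i) => // ->; rewrite ij.
exact: anticomm_sign.
Qed.

Lemma annih_vac i : annih i (vac : Fock R M) = 0.
Proof.
apply/ffunP => S; rewrite annihE !ffunE -cards_eq0 cardsU1.
by case: (i \in S) => //=; rewrite mulr0.
Qed.

Lemma creat_ket j S : j \notin S -> creat j (ket S) = jw_sign j S *: ket (j |: S) :> Fock R M.
Proof.
move=> jS; apply/ffunP => T; rewrite creatE !ffunE.
case: ifP => jT; last first.
  by case: eqP => [E|_]; [rewrite E setU11 in jT | rewrite scaler0].
case: (eqVneq T (j |: S)) => [->|n]; first by rewrite setU1K // eqxx jw_signU // ltnn mul1r.
by case: eqP => [E|_]; [case/eqP: n; rewrite -E setD1K | rewrite mulr0 scaler0].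
Qed.

Lemma enum_rank_split j : exists t1 t2,
  enum M = t1 ++ j :: t2 /\ forall i, (enum_rank i < enum_rank j)%N = (i \in t1).
Proof.
have jM : j \in enum M by rewrite mem_enum.
exists (take (index j (enum M)) (enum M)), (drop (index j (enum M)).+1 (enum M)).
split.
  rewrite -[in X in X :: _](nth_index j jM) -drop_nth ?index_mem //.
  by rewrite cat_take_drop.
have rk i : enum_rank i = index i (enum M) :> nat.
  by rewrite -{2}(nth_enum_rank j i) index_uniq ?enum_uniq // -cardE ltn_ord.
by move=> i; rewrite !rk in_take // mem_enum.
Qed.

Lemma enum_split j S : j \notin S -> exists t1 t2,
  [/\ enum S = t1 ++ t2, enum (j |: S) = t1 ++ j :: t2
    & #|[set i in S | (enum_rank i < enum_rank j)%N]| = size t1].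
Proof.
move=> jS; have [t1 [t2 [E rkE]]] := enum_rank_split j.
have := enum_uniq M; rewrite E cat_uniq /= negb_or.
case/and3P => _ /andP[jt1 /hasPn t12] /andP[jt2 _].
have enumE (A : {set M}) : enum A = filter (mem A) t1 ++ filter (mem A) (j :: t2).
  by rewrite -filter_cat -E enumT.
exists (filter (mem S) t1), (filter (mem S) t2); split.
- by rewrite enumE /= (negbTE jS).
- rewrite enumE /= setU11; congr (_ ++ _ :: _); apply: eq_in_filter => i it /=.
    by rewrite !inE; case: eqVneq it jt1 => // -> ->.
  by rewrite !inE; case: eqVneq it jt2 => // -> ->.
- rewrite cardE enumE size_cat [X in (_ + size X)%N](_ : _ = [::]) ?addn0.
    by congr size; apply: eq_in_filter => i it /=; rewrite !inE rkE it andbT.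
  rewrite -(filter_pred0 (j :: t2)); apply: eq_in_filter => i it /=.
  rewrite !inE rkE; apply/negbTE; rewrite negb_and orbC.
  by move: it; rewrite inE => /orP[/eqP->|/t12 ->]; rewrite ?jt1.
Qed.

Lemma creat_sqr i v : creat i (creat i v) = 0.
Proof.
apply/ffunP => S; rewrite !creatE !ffunE !inE eqxx /=.
by rewrite mulr0 if_same.
Qed.

Lemma creat_swap i j v : creat i (creat j v) = - creat j (creat i v).
Proof. by apply/eqP; rewrite -addr_eq0 creat_anticomm. Qed.

Lemma creat_slater s j t1 t2 :
  creat (s j) (slater s (t1 ++ t2)) = (-1) ^+ size t1 *: slater s (t1 ++ j :: t2)
  :> Fock R M.
Proof.
elim: t1 => [|i t1 IH] /=; first by rewrite scale1r.
by rewrite creat_swap IH linearZ /= exprS mulN1r scaleNr.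
Qed.

Lemma creat_slater_enum s j S : j \notin S ->
  creat (s j) (slater s (enum S)) = jw_sign j S *: slater s (enum (j |: S))
  :> Fock R M.
Proof.
by move=> /enum_split[t1 [t2 [-> -> E]]]; rewrite creat_slater /jw_sign E.
Qed.

Lemma creat_slater0 s j S : j \in S -> creat (s j) (slater s (enum S)) = 0 :> Fock R M.
Proof.
move=> jS; have /(creat_slater_enum s)/(congr1 (creat (s j))) : j \notin S :\ j.
  by rewrite setD11.
rewrite creat_sqr setD1K // linearZ /= => /esym/eqP.
by rewrite scaler_eq0 signr_eq0 => /eqP.
Qed.

Lemma ket_slater S : ket S = slater id (enum S) :> Fock R M.
Proof.
have [n] := ubnP #|S|; elim: n S => // n IH S.
have [->|[j jS]] := set_0Vmem S; first by rewrite enum_set0.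
rewrite (cardsD1 j) jS add1n ltnS => Sn.
have nj : j \notin S :\ j by rewrite setD11.
have := creat_ket nj; rewrite (IH _ Sn) (creat_slater_enum id nj) setD1K //.
by move=> /(congr1 (fun w => jw_sign j (S :\ j) *: w)); rewrite !scalerA jw_sqr !scale1r.
Qed.

Lemma relabelE s v : relabel s v = \sum_(S : {set M}) v S *: slater s (enum S).
Proof. by rewrite /relabel lfunE. Qed.

Lemma relabel_ket s S : relabel s (ket S) = slater s (enum S) :> Fock R M.
Proof.
rewrite relabelE (bigD1 S) //= big1 ?addr0 => [|T /negbTE TS].
  by rewrite ffunE eqxx scale1r.
by rewrite ffunE TS scale0r.
Qed.

Lemma relabel_vac s : relabel s vac = vac :> Fock R M.
Proof. by rewrite relabel_ket enum_set0. Qed.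

Lemma Fock_sum_ket v : v = \sum_(S : {set M}) v S *: ket S.
Proof.
apply/ffunP => T; rewrite sum_ffunE (bigD1 T) //= big1 ?addr0 => [|S /negbTE TS].
  by rewrite !ffunE eqxx; rewrite /GRing.scale /= mulr1.
by rewrite !ffunE eq_sym TS scaler0.
Qed.

Lemma relabel_creat s j v : relabel s (creat j v) = creat (s j) (relabel s v).
Proof.
rewrite (Fock_sum_ket v) !linear_sum /=; apply: eq_bigr => S _.
rewrite !linearZ /= relabel_ket; congr (_ *: _).
have [jS|jS] := boolP (j \in S).
  by rewrite creat_slater0 // ket_slater (creat_slater0 id jS) linear0.
by rewrite creat_slater_enum // creat_ket // linearZ /= relabel_ket.
Qed.

End FockFacts.

Section FreeFermions.
Variables (R : realType) (d L N : nat).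
Local Notation C := R[i].
Local Notation cell := (lattice d L).
Local Notation orb := (mode d L N).
Local Notation FockSp := (Fock R orb).

(* h x i j is the entry (i, j) of the one-body matrix h_x of the local term   *)
(* at the cell x.                                                             *)
Implicit Types (h : cell -> orb -> orb -> C) (c : cell -> R).

Definition hermitian_terms h : Prop :=
  forall x i j, h x j i = (h x i j)^*%R.

Definition finite_range (r : R) h : Prop :=
  forall (x y y' : cell) (tau tau' : 'I_N),
    r < torus_dist R y x \/ r < torus_dist R y' x ->
    h x (y, tau) (y', tau') = 0.

Definition local_term h c (x : cell) : 'End(FockSp) :=
  quadratic (h x) + (c x)%:C%C *: \1%VF.

Definition hamiltonian h c : 'End(FockSp) := \sum_x local_term h c x.

Definition translation (a : cell) : 'End(FockSp) := relabel (shift_mode a).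

Definition translation_invariant (A : 'End(FockSp)) : Prop :=
  forall a, (translation a \o A)%VF = (A \o translation a)%VF.

Definition frustration_free h c : Prop :=
  exists E : cell -> R,
    (forall x, smallest_eigenvalue (local_term h c x) (E x)) /\
    exists2 Phi : FockSp, Phi != 0 &
      forall x, local_term h c x Phi = (E x)%:C%C *: Phi.

(* The Bloch operators, with V = L^d: these formulas invert                   *)
(* c+_{x tau} = V^(-1/2) \sum_k exp (- i k.x) c+_{k tau}.                    *)
Definition bloch_norm : C := ((Num.sqrt (L ^ d)%:R)^-1)%:C%C.

Definition bloch_creat (k : momentum d L) (tau : 'I_N) : 'End(FockSp) :=
  bloch_norm *: \sum_(x : cell) plane_wave R k x *: creat (x, tau).

Definition bloch_annih (k : momentum d L) (tau : 'I_N) : 'End(FockSp) :=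
  bloch_norm *: \sum_(x : cell) (plane_wave R k x)^*%R *: annih (x, tau).

Definition bloch_hamiltonian (A : 'End(FockSp)) (H : momentum d L -> 'M[C]_N) :
    Prop :=
  (forall k, (H k)^t* = H k) /\
  exists a : R,
    A = \sum_k \sum_tau \sum_tau'
          H k tau tau' *: (bloch_creat k tau \o bloch_annih k tau')%VF
        + a%:C%C *: \1%VF.

(* The eigenvectors of H_k are the columns of U k. *)
Definition diagonalizes (H : momentum d L -> 'M[C]_N)
    (eps : momentum d L -> 'I_N -> R) (U : momentum d L -> 'M[C]_N) : Prop :=
  forall k, U k \is unitarymx /\
    H k = U k *m diag_mx (\row_n (eps k n)%:C%C) *m (U k)^t*.

Definition band_creat (U : momentum d L -> 'M[C]_N) (n : 'I_N)
    (k : momentum d L) : 'End(FockSp) :=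
  \sum_tau U k tau n *: bloch_creat k tau.

Definition occupied_space (eps : momentum d L -> 'I_N -> R)
    (U : momentum d L -> 'M[C]_N) : {vspace FockSp} :=
  (\sum_k \sum_(n | (eps k n < 0)%R) <[band_creat U n k vac]>)%VS.

Definition one_particle_state (f : cell -> 'I_N -> C) : FockSp :=
  \sum_(y : cell) \sum_tau f y tau *: creat (y, tau) vac.

Definition supported_near (r : R) (x : cell) (w : FockSp) : Prop :=
  exists2 f : cell -> 'I_N -> C, w = one_particle_state f &
    forall y tau, f y tau != 0 -> torus_dist R y x <= r.

End FreeFermions.

Section Matrices.
Variables (R : realType) (n : nat).
Implicit Types (A P Q : 'M[R[i]]_n).

Definition psdmx A : Prop :=
  A^t* = A /\ forall v : 'cV[R[i]]_n, 0 <= (v^t* *m A *m v) 0 0.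

Definition posneg_parts A P Q : Prop :=
  [/\ A = P + Q, psdmx P, psdmx (- Q) & P *m Q = 0].

(* The eigenvalues of A with multiplicity, in increasing order. *)
Definition ordered_eigenvalues A (w : 'I_n -> R) : Prop :=
  char_poly A = \prod_(m < n) ('X - ((w m)%:C%C)%:P) /\
  forall m m' : 'I_n, (m <= m')%N -> w m <= w m'.

End Matrices.

(* Main.v *)
(** If h u = e u for a one-body matrix h, then the commutator of the quadratic
    Fock operator of h with c+(u) is e c+(u), so for e < 0 (resp. with c(w),
    e > 0) it would lower the energy of a ground state: a common ground state
    Phi is killed by c+(u) for every negative eigenvector u of every h_x and by
    c(w) for every positive eigenvector w of every h_y.  The anticommutator
    {c(w), c+(u)} = <w, u> then forces <w, u> = 0, i.e. the positive part of h_y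
    annihilates the negative part of h_x for all x and y.  Hence the negative
    part of sum_x h_x is the sum of the negative parts of the h_x, and its
    range, the occupied space, is spanned by the negative eigenvectors of the
    individual h_x, which are supported within distance r of x. *)
Require Import Defs.
From HB Require Import structures.
From mathcomp Require Import all_boot all_order all_algebra.
From mathcomp Require Import complex.
From mathcomp Require Import reals trigo.
From mathcomp Require Import ring lra.

Set Implicit Arguments.
Unset Strict Implicit.
Unset Printing Implicit Defensive.

Import Order.TTheory GRing.Theory Num.Theory.
Local Open Scope ring_scope.
Local Open Scope sesquilinear_scope.

(** * Ladder operators of one-body matrices and their action on ground states *)

Section OneBody.
Variables (R : realType) (M : finType).
Local Notation C := R[i].
Implicit Types (i j k : M) (v : Fock R M) (h : M -> M -> C).
Implicit Types (u : 'cV[C]_#|M|) (w : 'rV[C]_#|M|).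

Definition mode_mx h : 'M[C]_#|M| := \matrix_(a, b) h (enum_val a) (enum_val b).

(** [creatv] takes a column and [annihv] a row, both without conjugation, so each is linear and
    accepts right, respectively left, eigenvectors of [mode_mx h] directly. *)
Definition creatv u : 'End(Fock R M) := \sum_i u (enum_rank i) 0 *: creat i.

Definition annihv w : 'End(Fock R M) := \sum_i w 0 (enum_rank i) *: annih i.

Lemma creatvE u v : creatv u v = \sum_i u (enum_rank i) 0 *: creat i v.
Proof. by rewrite sum_lfunE; apply: eq_bigr => i _; rewrite lfunE. Qed.

Lemma annihvE w v : annihv w v = \sum_i w 0 (enum_rank i) *: annih i v.
Proof. by rewrite sum_lfunE; apply: eq_bigr => i _; rewrite lfunE. Qed.

Lemma creatvP a u u' v : creatv (a *: u + u') v = a *: creatv u v + creatv u' v.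
Proof.
rewrite !creatvE scaler_sumr -big_split; apply: eq_bigr => i _ /=.
by rewrite !mxE scalerDl scalerA.
Qed.

Lemma creatvZ a u v : creatv (a *: u) v = a *: creatv u v.
Proof.
rewrite !creatvE scaler_sumr; apply: eq_bigr => i _.
by rewrite mxE scalerA.
Qed.

Lemma annihvZ a w v : annihv (a *: w) v = a *: annihv w v.
Proof.
rewrite !annihvE scaler_sumr; apply: eq_bigr => i _.
by rewrite mxE scalerA.
Qed.

Lemma quadraticE h v :
  quadratic h v = \sum_i \sum_j h i j *: creat i (annih j v).
Proof.
rewrite sum_lfunE; apply: eq_bigr => i _; rewrite sum_lfunE.
by apply: eq_bigr => j _; rewrite lfunE /= comp_lfunE.
Qed.

Lemma annih_creat i j v :
  annih i (creat j v) = (i == j)%:R *: v - creat j (annih i v).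
Proof. by rewrite -annih_creat_anticomm addrK. Qed.

Lemma creat_annih i j v :
  creat i (annih j v) = (j == i)%:R *: v - annih j (creat i v).
Proof. by rewrite -annih_creat_anticomm addrC addKr. Qed.

Lemma annih_swap i j v : annih i (annih j v) = - annih j (annih i v).
Proof. by apply/eqP; rewrite -addr_eq0 annih_anticomm. Qed.

Lemma sum_delta (V : lmodType C) j (F : M -> V) :
  \sum_i (i == j)%:R *: F i = F j.
Proof.
rewrite (bigD1 j) //= eqxx scale1r big1 ?addr0 // => i /negbTE ->.
by rewrite scale0r.
Qed.

Lemma quadratic_creat h k v :
  quadratic h (creat k v) = creat k (quadratic h v) + \sum_i h i k *: creat i v.
Proof.
rewrite !quadraticE linear_sum -big_split; apply: eq_bigr => i _ /=.
rewrite linear_sum.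
transitivity (\sum_j (creat k (h i j *: creat i (annih j v)) +
   (j == k)%:R *: (h i j *: creat i v))).
  apply: eq_bigr => j _; rewrite annih_creat linearB /= creat_swap opprK.
  by rewrite scalerDr addrC !linearZ /= scalerA mulrC -scalerA.
by rewrite big_split /= sum_delta.
Qed.

Lemma quadratic_annih h k v :
  quadratic h (annih k v) = annih k (quadratic h v) - \sum_j h k j *: annih j v.
Proof.
(* Writing the subtracted sum as a sum over [i] with a Kronecker delta allows a term-by-term
   comparison. *)
have := sum_delta k (fun i => \sum_j h i j *: annih j v) => /= <-.
rewrite !quadraticE linear_sum -sumrB.
apply: eq_bigr => i _ /=; rewrite linear_sum scaler_sumr -sumrB.
apply: eq_bigr => j _ /=; rewrite [annih k (_ *: _)]linearZ /=.
rewrite annih_swap [creat i (- _)]linearN /= (creat_annih i k) opprB scalerBr.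
by rewrite [k == i]eq_sym; congr (_ - _); rewrite !scalerA mulrC.
Qed.

Lemma mode_mxE h i j : mode_mx h (enum_rank i) (enum_rank j) = h i j.
Proof. by rewrite mxE !enum_rankK. Qed.

Lemma sum_mode (F : 'I_#|M| -> C) : \sum_a F a = \sum_i F (enum_rank i).
Proof. by rewrite (reindex enum_rank) //; apply/onW_bij/enum_rank_bij. Qed.

(** The commutator with [quadratic h] acts on [u] through [mode_mx h], so a right eigenvector turns
    [creatv u] into a ladder operator. *)
Lemma quadratic_creatv h u v :
  quadratic h (creatv u v) =
  creatv u (quadratic h v) + creatv (mode_mx h *m u) v.
Proof.
rewrite (creatvE u v) linear_sum /=.
under eq_bigr => k _ do rewrite linearZ /= quadratic_creat scalerDr.
rewrite big_split -creatvE; congr (_ + _); rewrite creatvE /=.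
under eq_bigr => k _ do rewrite scaler_sumr.
rewrite exchange_big; apply: eq_bigr => i _; rewrite !mxE sum_mode scaler_suml.
by apply: eq_bigr => k _; rewrite mode_mxE scalerA mulrC.
Qed.

Lemma quadratic_annihv h w v :
  quadratic h (annihv w v) =
  annihv w (quadratic h v) - annihv (w *m mode_mx h) v.
Proof.
rewrite (annihvE w v) linear_sum /=.
under eq_bigr => k _ do rewrite linearZ /= quadratic_annih scalerBr.
rewrite sumrB -annihvE; congr (_ - _); rewrite annihvE /=.
under eq_bigr => k _ do rewrite scaler_sumr.
rewrite exchange_big; apply: eq_bigr => i _; rewrite !mxE sum_mode scaler_suml.
by apply: eq_bigr => k _; rewrite mode_mxE scalerA.
Qed.

Lemma annihv_creatv_anticomm w u v :
  annihv w (creatv u v) + creatv u (annihv w v) = (w *m u) 0 0 *: v.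
Proof.
rewrite mxE sum_mode scaler_suml (annihvE w (creatv u v)) (annihvE w v) linear_sum.
rewrite -big_split; apply: eq_bigr => i _ /=.
rewrite linearZ /= !creatvE linear_sum /= -scalerDr -scalerA; congr (_ *: _).
rewrite -(sum_delta i (fun j => u (enum_rank j) 0 *: v)) -big_split.
apply: eq_bigr => j _ /=; rewrite linearZ /= -scalerDr annih_creat_anticomm.
by rewrite eq_sym !scalerA mulrC.
Qed.

Lemma leigenvalue_vec (A : 'End(Fock R M)) e v :
  A v = e *: v -> v != 0 -> passmx.leigenvalue A e.
Proof.
move=> Av v0; rewrite /passmx.leigenvalue /passmx.leigenspace.
apply: contraNneq v0 => K0; rewrite -memv0 -K0 memv_ker.
by rewrite !lfunE /= opp_lfunE scale_lfunE id_lfunE Av subrr.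
Qed.

Variables (h : M -> M -> C) (c : C) (E : R) (Phi : Fock R M).
Let T : 'End(Fock R M) := quadratic h + c *: \1%VF.
Hypotheses (TE : smallest_eigenvalue T E) (TPhi : T Phi = E%:C%C *: Phi).

Let TE_app v : T v = quadratic h v + c *: v.
Proof. by rewrite lfunE /= scale_lfunE id_lfunE. Qed.

(** A nonzero [v] would be an eigenvector below the smallest eigenvalue; in the order of [R[i]],
    [e < 0] already makes [e] real. *)
Lemma lowering_eq0 e v : e < 0 -> T v = (E%:C%C + e) *: v -> v = 0.
Proof.
move=> e0 Tv; apply/eqP; case: eqVneq => // v0.
have := TE.2 _ (leigenvalue_vec Tv v0).
by rewrite lerDl => /(lt_le_trans e0); rewrite ltxx.
Qed.

Lemma ground_creatv e u : mode_mx h *m u = e *: u -> e < 0 -> creatv u Phi = 0.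
Proof.
move=> hu e0; apply: (lowering_eq0 e0); rewrite TE_app quadratic_creatv hu.
rewrite creatvZ scalerDl -[E%:C%C *: _]linearZ /= -TPhi TE_app.
rewrite [creatv u (_ + _)]linearD (linearZ_LR (creatv u)) /=.
exact: addrAC.
Qed.

Lemma ground_annihv e w : w *m mode_mx h = e *: w -> 0 < e -> annihv w Phi = 0.
Proof.
move=> hw e0; apply: (@lowering_eq0 (- e)); rewrite ?oppr_lt0 //.
rewrite TE_app quadratic_annihv hw.
rewrite annihvZ scalerDl scaleNr -[E%:C%C *: _]linearZ /= -TPhi TE_app.
rewrite [annihv w (_ + _)]linearD (linearZ_LR (annihv w)) /=.
exact: addrAC.
Qed.

End OneBody.

(** * Gram matrices and the signed splitting of a Hermitian matrix *)

Section Gram.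
Variables (C : numClosedFieldType) (n : nat).
Implicit Types (A B : 'M[C]_n) (v : 'cV[C]_n).

Lemma adjmxM p q s (A : 'M[C]_(p, q)) (B : 'M[C]_(q, s)) :
  (A *m B)^t* = B^t* *m A^t*.
Proof. by rewrite trmx_mul map_mxM. Qed.

Lemma adjmx_row p q (A : 'M[C]_(p, q)) i : (row i A)^t* = col i (A^t*).
Proof. by apply/matrixP=> a b; rewrite !mxE. Qed.

Lemma adjmx_mul00E m (v : 'cV[C]_m) : (v^t* *m v) 0 0 = \sum_i `|v i 0| ^+ 2.
Proof. by rewrite mxE; apply: eq_bigr => i _; rewrite !mxE mulrC normCK. Qed.

Lemma adjmx_mul_ge0 m (v : 'cV[C]_m) : 0 <= (v^t* *m v) 0 0.
Proof. by rewrite adjmx_mul00E sumr_ge0 // => i _; rewrite exprn_ge0. Qed.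

Lemma adjmx_mul_eq0 m (v : 'cV[C]_m) : (v^t* *m v) 0 0 = 0 -> v = 0.
Proof.
rewrite adjmx_mul00E => /eqP; rewrite psumr_eq0 => [/allP v0|i _]; last first.
  exact: exprn_ge0.
apply/matrixP => i j; rewrite ord1 mxE; apply/eqP.
by rewrite -normr_eq0 -sqrf_eq0; apply: (v0 i); rewrite mem_index_enum.
Qed.

Lemma row_diag_mxM m p (d : 'rV[C]_m) (A : 'M[C]_(m, p)) i :
  row i (diag_mx d *m A) = d 0 i *: row i A.
Proof. by rewrite row_mul row_diag_mx -scalemxAl -rowE. Qed.

(** The squared norm of [G v] equals minus [v^t* G B v] up to adjoints, that is [- e] times
    [v^t* G v], hence is both nonnegative and nonpositive. So [G v = 0], and [v^t* G v], the sum of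
    the squared norms of the [K x v], vanishes term by term. *)
Lemma gram_ker (X : finType) (K : X -> 'M[C]_n) B v e (G := \sum_x (K x)^t* *m K x) :
    G *m B = - (G *m G) -> B *m v = e *: v -> 0 <= e ->
  forall x, K x *m v = 0.
Proof.
move=> GB Bv e0 x.
have G_herm : G^t* = G.
  rewrite /G linear_sum /= raddf_sum; apply: eq_bigr => y _ /=.
  by rewrite adjmxM trmxCK.
have vGv : (v^t* *m G *m v) 0 0 = \sum_y ((K y *m v)^t* *m (K y *m v)) 0 0.
  rewrite mulmx_sumr mulmx_suml summxE; apply: eq_bigr => y _.
  by rewrite adjmxM !mulmxA.
have terms_ge0 y : true -> 0 <= ((K y *m v)^t* *m (K y *m v)) 0 0.
  by move=> _; apply: adjmx_mul_ge0.
have vGv_ge0 : 0 <= (v^t* *m G *m v) 0 0 by rewrite vGv sumr_ge0.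
have GG : ((G *m v)^t* *m (G *m v)) 0 0 = - (e * (v^t* *m G *m v) 0 0).
  transitivity (- (v^t* *m (G *m B) *m v) 0 0).
    by rewrite GB mulmxN mulNmx [in RHS]mxE opprK adjmxM G_herm !mulmxA.
  by rewrite !mulmxA -mulmxA Bv -scalemxAr [in LHS]mxE.
have /adjmx_mul_eq0 Gv0 : ((G *m v)^t* *m (G *m v)) 0 0 = 0.
  by apply/le_anti; rewrite adjmx_mul_ge0 GG oppr_le0 mulr_ge0.
move: vGv; rewrite -mulmxA Gv0 mulmx0 mxE => /esym/eqP.
rewrite psumr_eq0 // => /allP/(_ x); rewrite mem_index_enum => /(_ isT).
by move=> /= /eqP/adjmx_mul_eq0.
Qed.

(* The rows of [K] are eigenvectors of [A] scaled by the square roots of the  *)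
(* absolute values of their eigenvalues; the rows of the wrong sign are zero. *)
Lemma hermitian_split A : A^t* = A ->
  exists Kp Km : 'M[C]_n,
  [/\ A = Kp^t* *m Kp - Km^t* *m Km,
      forall i, exists2 e : C, 0 < e & row i Kp *m A = e *: row i Kp
    & forall i, exists2 e : C, 0 < e & row i Km *m A = - e *: row i Km].
Proof.
move=> A_herm.
have hA : A \is hermsymmx by apply/is_hermitianmxP; rewrite expr0 scale1r A_herm.
have /hermitian_normalmx/orthomx_spectralP := hA.
have d_real i : spectral_diag A 0 i \is Num.real.
  by have /mxOverP := hermitian_spectral_diag_real hA; apply.
have := spectral_unitarymx A.
move: (spectralmx A) (spectral_diag A) d_real => P d d_real Pu AE.
have PP : P *m P^t* = 1%:M by apply/unitarymxP.
rewrite invmx_unitary // in AE.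
have PA i : row i P *m A = d 0 i *: row i P.
  by rewrite -row_mul AE !mulmxA PP mul1mx row_diag_mxM.
(* [s = 1] keeps the positive eigenvalues, [s = -1] the negative ones with their sign reversed. *)
pose part (s : C) : 'M[C]_n :=
  diag_mx (\row_i sqrtC (if 0 < s * d 0 i then s * d 0 i else 0)) *m P.
have partE s : (part s)^t* *m part s =
    P^t* *m diag_mx (\row_i (if 0 < s * d 0 i then s * d 0 i else 0)) *m P.
  rewrite adjmxM mulmxA; congr (_ *m _); rewrite -mulmxA; congr (_ *m _).
  rewrite tr_diag_mx map_diag_mx mulmx_diag; congr diag_mx.
  apply/matrixP => a b; rewrite !mxE /= geC0_conj ?sqrtC_ge0 -?expr2 ?sqrtCK //.
  by case: ifP => // /ltW.
exists (part 1), (part (-1)); split=> [|i|i].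
- rewrite !partE -mulmxBl -mulmxBr {1}AE -raddfB /=.
  congr (_ *m diag_mx _ *m _).
  apply/matrixP => a b; rewrite !mxE ord1 mul1r mulN1r oppr_gt0.
  case: (real_ltgt0P (d_real b)) => [d0|d0|->]; rewrite ?subr0 ?sub0r ?opprK ?subrr //.
- rewrite row_diag_mxM -scalemxAl PA mxE mul1r; case: ifP => di.
    by exists (d 0 i); rewrite // scalerA mulrC -scalerA.
  (* The row is zero here, hence satisfies the equation for any number; [1] is a placeholder. *)
  by exists 1; rewrite // sqrtC0 !scale0r scaler0.
- rewrite row_diag_mxM -scalemxAl PA mxE mulN1r; case: ifP => di.
    by exists (- d 0 i); rewrite // opprK scalerA mulrC -scalerA.
  by exists 1; rewrite // sqrtC0 !scale0r scaler0.
Qed.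

End Gram.

(** * Orthogonality forced by a common ground state *)

Section Frustration.
Variables (R : realType) (M : finType).
Local Notation C := R[i].

Lemma common_ground_state_orth (h h' : M -> M -> C) (c c' : C) (E E' : R)
    (Phi : Fock R M) (w u : 'rV[C]_#|M|) (e e' : C) :
    smallest_eigenvalue (quadratic h + c *: \1%VF) E ->
    smallest_eigenvalue (quadratic h' + c' *: \1%VF) E' ->
    (quadratic h + c *: \1%VF) Phi = E%:C%C *: Phi ->
    (quadratic h' + c' *: \1%VF) Phi = E'%:C%C *: Phi ->
    Phi != 0 -> (forall i j, h' j i = (h' i j)^*) ->
    w *m mode_mx h = e *: w -> 0 < e ->
    u *m mode_mx h' = - e' *: u -> 0 < e' ->
  (w *m u^t*) 0 0 = 0.
Proof.
move=> hE hE' hPhi hPhi' Phi0 h'_herm wh e0 uh' e'0.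
(* As [h'] is Hermitian and [e'] is real, the adjoint of a left eigenvector is a right eigenvector
   with the same eigenvalue. *)
have hu : mode_mx h' *m u^t* = - e' *: u^t*.
  have {1}-> : mode_mx h' = (mode_mx h')^t*.
    by apply/matrixP => a b; rewrite !mxE /= -h'_herm.
  rewrite -adjmxM uh' linearZ /= map_mxZ /= rmorphN /= geC0_conj //.
  exact: ltW.
have := annihv_creatv_anticomm w (u^t*) Phi.
have ne' : - e' < 0 by rewrite oppr_lt0.
rewrite (ground_creatv hE' hPhi' hu ne') (ground_annihv hE hPhi wh e0) !linear0 addr0.
by move=> /esym/eqP; rewrite scaler_eq0 (negbTE Phi0) orbF => /eqP.
Qed.

End Frustration.

(** * Roots of unity and orthogonality of plane waves *)

Section RootsOfUnity.
Variable (R : realType).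
Local Notation expi := (@expi R).

Lemma expiD s t : expi (s + t) = expi s * expi t.
Proof. by rewrite /expi cosD sinD; simpc; congr (_ +i* _)%C; ring. Qed.

Lemma expi0 : expi 0 = 1.
Proof. by rewrite /expi cos0 sin0. Qed.

Lemma expi_sum (I : finType) (F : I -> R) :
  expi (\sum_i F i) = \prod_i expi (F i).
Proof. exact: (big_morph expi expiD expi0). Qed.

Lemma expiMn t n : expi (t *+ n) = expi t ^+ n.
Proof. by elim: n => [|n IH]; rewrite ?expi0 // mulrS expiD IH exprS. Qed.

Lemma conj_expi_mul t : (expi t)^* * expi t = 1.
Proof.
rewrite -normCKC normc_def /= cos2Dsin2 sqrtr1.
exact: expr1n.
Qed.

Lemma expi_prim_root L : (0 < L)%N -> L.-primitive_root (expi (2 * pi / L%:R)).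
Proof.
move=> L0; have L0' : (0 : R) < L%:R by rewrite ltr0n.
apply/andP; split=> //; apply/forallP => m; apply/eqP.
rewrite unity_rootE -expiMn; have [mL|mL] := eqVneq m.+1 L.
  rewrite mL -[_ *+ L]mulr_natr mulfVK ?(gt_eqF L0') // mulr_natl.
  by rewrite /expi cos2pi sin2pi !eqxx.
have {}mL : (m.+1 < L)%N by rewrite ltn_neqAle mL ltn_ord.
(* Half the angle of the power: [cos (2 t) = 1] would force [sin t = 0], impossible for
   [0 < t < pi]. *)
pose t : R := pi * m.+1%:R / L%:R.
have -> : 2 * pi / L%:R *+ m.+1 = t *+ 2.
  by rewrite /t -[LHS]mulr_natr -[RHS]mulr_natr; ring.
have t_pi : 0 < t < pi.
  rewrite /t divr_gt0 ?mulr_gt0 ?pi_gt0 ?ltr0n //=.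
  by rewrite ltr_pdivrMr // ltr_pM2l ?pi_gt0 // ltr_nat.
apply/negbTE/eqP => -[]; rewrite cos_mulr2n cos2sin2 => Ht _.
have := sin_gt0_pi t_pi.
have -> : sin t = 0 by apply/eqP; rewrite -sqrf_eq0; apply/eqP; lra.
by rewrite ltxx.
Qed.

End RootsOfUnity.

(** The sum over cells factors into one geometric sum per coordinate; where [k] and [q] differ, its
    ratio is an [L]-th root of unity other than 1 and the sum vanishes. *)
Lemma plane_wave_orth (R : realType) d L (k q : momentum d L) : (0 < L)%N ->
  \sum_x (plane_wave R k x)^* * plane_wave R q x = (L ^ d)%:R * (k == q)%:R.
Proof.
move=> L0; pose z := expi (2 * pi / L%:R : R).
have zz : z^* * z = 1 by apply: conj_expi_mul.
have zP : L.-primitive_root z by apply: expi_prim_root.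
have pwE (p x : momentum d L) : plane_wave R p x = \prod_i (z ^+ p i) ^+ x i.
  rewrite /plane_wave mulr_sumr expi_sum; apply: eq_bigr => i _.
  by rewrite -exprM -expiMn -[_ *+ (_ * _)]mulr_natr natrM.
transitivity (\prod_(i < d) \sum_(a < L.-1.+1) ((z^* ^+ k i) * (z ^+ q i)) ^+ a).
  rewrite bigA_distr_bigA /=; apply: eq_bigr => x _.
  rewrite !pwE rmorph_prod -big_split; apply: eq_bigr => i _ /=.
  by rewrite !rmorphXn exprMn.
have sumE (a b : 'I_L.-1.+1) :
    \sum_(m < L.-1.+1) (z^* ^+ a * z ^+ b) ^+ m = L%:R * (a == b)%:R.
  have [<-|ab] := eqVneq a b.
    rewrite -exprMn zz mulr1 expr1n.
    rewrite (eq_bigr (fun=> 1)) => [|i _]; last exact: expr1n.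
    by rewrite sumr_const card_ord prednK.
  rewrite mulr0; apply/eqP; set w := _ * _.
  have w1 : w - 1 != 0.
    rewrite subr_eq0; apply: contra ab => /eqP w1.
    have : z ^+ a == z ^+ b.
      by rewrite -[z ^+ a]mulr1 -w1 /w mulrA -exprMn [z * _]mulrC zz expr1n mul1r.
    rewrite (eq_prim_root_expr zP) => /eqP; rewrite !modn_small => [/val_inj ->//||].
      by rewrite -[X in (_ < X)%N](prednK L0) ltn_ord.
    by rewrite -[X in (_ < X)%N](prednK L0) ltn_ord.
  have := subrX1 w L; rewrite [X in X - 1](_ : _ = 1) ?subrr.
    by move=> /esym/eqP; rewrite mulf_eq0 (negbTE w1) /= => /eqP; rewrite -!(big_mkord xpredT (fun m => w ^+ m)) (prednK L0) => /eqP.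
  rewrite /w exprMn -!exprM mulnC [(b * L)%N]mulnC !exprM -rmorphXn.
  by rewrite (prim_expr_order zP) rmorph1 !expr1n mulr1.
under eq_bigr => i _ do rewrite sumE.
rewrite big_split /= prodr_const card_ord natrX; congr (_ * _).
have [->|kq] := eqVneq k q; first by rewrite big1 // => i _; rewrite eqxx.
have /forallPn [i ki] : ~~ [forall i, k i == q i].
  apply: contra kq => /forallP kqi; apply/eqP/ffunP => i; exact/eqP.
by rewrite (bigD1 i) //= (negbTE ki) mul0r.
Qed.

(** * One-particle states and matrix elements *)

Section OneParticle.
Variables (R : realType) (M : finType).
Local Notation C := R[i].

Definition one_particle (u : 'cV[C]_#|M|) : Fock R M := creatv u vac.

Fact one_particle_is_linear : linear one_particle.
Proof. by move=> a u v; rewrite /one_particle creatvP. Qed.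
HB.instance Definition _ :=
  GRing.isLinear.Build _ _ _ _ one_particle one_particle_is_linear.

Lemma add_scale1_lfunE (A : 'End(Fock R M)) (a : C) v :
  (A + a *: \1%VF) v = A v + a *: v.
Proof. by rewrite lfunE /= scale_lfunE id_lfunE. Qed.

Lemma creat_vac (i : M) : creat i vac = ket [set i] :> Fock R M.
Proof.
rewrite creat_ket ?inE // setU0 /jw_sign (_ : [set _ in _ | _] = set0).
  by rewrite cards0 scale1r.
by apply/setP => j; rewrite !inE.
Qed.

Lemma creat_vac_set1 (i j : M) : creat i vac [set j] = (j == i)%:R :> C.
Proof. by rewrite creat_vac ffunE (inj_eq set1_inj). Qed.

Lemma quadratic_vac (g : M -> M -> C) : quadratic g vac = 0.
Proof.
rewrite quadraticE big1 // => i _; rewrite big1 // => j _.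
by rewrite annih_vac linear0 scaler0.
Qed.

Lemma quadratic_creat_vac (g : M -> M -> C) i j :
  quadratic g (creat j vac) [set i] = g i j.
Proof.
rewrite quadratic_creat quadratic_vac linear0 add0r sum_ffunE.
rewrite (bigD1 i) //= big1 ?addr0 => [|k ki]; rewrite ffunE creat_vac_set1.
  by rewrite eqxx; apply: mulr1.
by rewrite eq_sym (negbTE ki) scaler0.
Qed.

(** Both operators kill the vacuum, so the vacuum component of the identity compares [a] with [b].
    This removes the additive constant left free by the Bloch form. *)
Lemma quadratic_addI (g : M -> M -> C) (B : 'End(Fock R M)) a b :
  quadratic g + a *: \1%VF = B + b *: \1%VF -> B vac = 0 -> quadratic g = B.
Proof.
move=> gB B_vac; suff ab : a = b by move: gB; rewrite ab => /addIr.
have gB_vac : quadratic g vac + a *: vac = B vac + b *: vac :> Fock R M.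
  by rewrite -(add_scale1_lfunE (quadratic g)) gB add_scale1_lfunE.
move: gB_vac; rewrite quadratic_vac B_vac !add0r => /ffunP/(_ set0).
rewrite !ffunE eqxx.
by rewrite /GRing.scale /= !mulr1.
Qed.

Lemma scale_comp_lfunE (A B : 'End(Fock R M)) (b c : C) v w :
  B v = b *: w -> (c *: (A \o B)%VF) v = (c * b) *: A w.
Proof. by move=> Bv; rewrite scale_lfunE comp_lfunE Bv linearZ scalerA. Qed.

End OneParticle.

(** * The Bloch basis and its eigenvalue equation in real space *)

Section Bloch.
Variables (R : realType) (d L N : nat).
Hypothesis L_gt0 : (0 < L)%N.
Local Notation C := R[i].
Local Notation orb := (mode d L N).

Implicit Types (k : momentum d L) (n tau : 'I_N).

Lemma bloch_norm_sqr : bloch_norm R d L * bloch_norm R d L * (L ^ d)%:R = 1.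
Proof.
rewrite /bloch_norm -(rmorph_nat (real_complex R)) -!rmorphM /= -invfM.
rewrite -expr2 sqr_sqrtr ?ler0n // mulVf ?rmorph1 //.
by rewrite pnatr_eq0 -lt0n expn_gt0 L_gt0.
Qed.

Lemma bloch_norm_conj : (bloch_norm R d L)^* = bloch_norm R d L.
Proof. exact: conjc_real. Qed.

(** Rows are indexed by (cell, orbital), columns by (momentum, band); [mode d L N] encodes both
    because momenta and cells share one type. *)
Definition bloch_mx (U : momentum d L -> 'M[C]_N) : 'M[C]_#|{: orb}| :=
  mode_mx (fun i j => bloch_norm R d L * plane_wave R j.1 i.1 * U j.1 i.2 j.2).

Lemma sum_pair_mode (F : orb -> C) : \sum_i F i = \sum_x \sum_tau F (x, tau).
Proof. by rewrite pair_big; apply: eq_bigr => -[]. Qed.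

(** Plane-wave orthogonality separates different momenta; at equal momentum the unitarity of [U k]
    remains. *)
Lemma bloch_mx_unitary U : (forall k, U k \is unitarymx) ->
  (bloch_mx U)^t* *m bloch_mx U = 1%:M.
Proof.
move=> U_unitary; apply/matrixP => a b; rewrite !mxE sum_mode.
set p := enum_val a; set q := enum_val b.
transitivity (\sum_(i : orb) (bloch_norm R d L * bloch_norm R d L) *
   ((plane_wave R p.1 i.1)^* * plane_wave R q.1 i.1) *
   ((U p.1 i.2 p.2)^* * U q.1 i.2 q.2)).
  apply: eq_bigr => i _; rewrite !mxE !enum_rankK -/p -/q !rmorphM /=.
  by rewrite bloch_norm_conj; ring.
rewrite sum_pair_mode /=.
transitivity ((bloch_norm R d L * bloch_norm R d L) *
   (\sum_x (plane_wave R p.1 x)^* * plane_wave R q.1 x) *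
   \sum_tau ((U p.1 tau p.2)^* * U q.1 tau q.2)).
  rewrite [X in _ = X * _]mulr_sumr mulr_suml; apply: eq_bigr => x _.
  by rewrite mulr_sumr.
rewrite plane_wave_orth // mulrA bloch_norm_sqr mul1r.
rewrite -(inj_eq enum_val_inj) -/p -/q.
have [pq|pq] := eqVneq p.1 q.1; last first.
  by rewrite mul0r; case: (eqVneq p q) pq => // ->; rewrite eqxx.
have /unitarymxP/mulmx1C/matrixP/(_ p.2 q.2) := U_unitary q.1.
have -> : (p == q) = (p.2 == q.2).
  by rewrite [p]surjective_pairing [q]surjective_pairing xpair_eqE pq eqxx.
rewrite pq mul1r !mxE => <-.
by apply: eq_bigr => tau _; rewrite !mxE.
Qed.

Lemma band_creat_vac U n k :
  band_creat U n k vac = one_particle (col (enum_rank (k, n)) (bloch_mx U)).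
Proof.
rewrite /one_particle creatvE sum_lfunE.
under eq_bigr => tau _ do rewrite !scale_lfunE sum_lfunE !scaler_sumr.
rewrite exchange_big pair_big; apply: eq_bigr => -[x tau] _ /=.
rewrite scale_lfunE !scalerA !mxE !enum_rankK /=; congr (_ *: _); ring.
Qed.

Lemma bloch_annih_vac k tau : bloch_annih R k tau vac = 0.
Proof.
rewrite scale_lfunE sum_lfunE big1 ?scaler0 // => x _.
by rewrite scale_lfunE annih_vac scaler0.
Qed.

Lemma bloch_annih_creat_vac k tau (j : orb) :
  bloch_annih R k tau (creat j vac) =
  (bloch_norm R d L * (plane_wave R k j.1)^* * (tau == j.2)%:R) *: vac.
Proof.
case: j => y s /=; rewrite scale_lfunE sum_lfunE -!scalerA; congr (_ *: _).
rewrite (bigD1 y) //= big1 ?addr0 => [|x /negbTE xy]; rewrite scale_lfunE.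
  by rewrite annih_creat annih_vac linear0 subr0 xpair_eqE eqxx.
rewrite annih_creat annih_vac linear0 subr0.
by rewrite xpair_eqE xy scale0r scaler0.
Qed.

Lemma bloch_creat_vac_set1 k tau (i : orb) :
  bloch_creat R k tau vac [set i] =
  bloch_norm R d L * plane_wave R k i.1 * (tau == i.2)%:R.
Proof.
case: i => y s /=; rewrite scale_lfunE sum_lfunE ffunE -mulrA; congr (_ * _).
rewrite sum_ffunE (bigD1 y) //= big1 ?addr0 => [|x /negbTE xy].
  by rewrite scale_lfunE ffunE creat_vac_set1 xpair_eqE eqxx eq_sym.
rewrite scale_lfunE ffunE creat_vac_set1.
by rewrite xpair_eqE eq_sym xy; apply: mulr0.
Qed.

(** Apply both forms of the operator to the one-particle state of [j] and read off the component on
    [[set i]]. *)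
Lemma bloch_matrix_elements (g : orb -> orb -> C) (a : C) (H : momentum d L -> 'M[C]_N) i j :
    bloch_hamiltonian (quadratic g + a *: \1%VF) H ->
  g i j = \sum_k H k i.2 j.2 * (bloch_norm R d L * plane_wave R k i.1 *
    (bloch_norm R d L * (plane_wave R k j.1)^*)).
Proof.
move=> [_ [b /quadratic_addI gH]]; rewrite -quadratic_creat_vac gH; last first.
  rewrite sum_lfunE; apply: big1 => k _; rewrite sum_lfunE; apply: big1 => tau _.
  rewrite sum_lfunE; apply: big1 => tau' _.
  have B0 : bloch_annih R k tau' vac = 0 *: vac by rewrite bloch_annih_vac scale0r.
  by rewrite (scale_comp_lfunE _ _ B0) mulr0 scale0r.
rewrite sum_lfunE sum_ffunE; apply: eq_bigr => k _.
transitivity (\sum_tau \sum_tau' H k tau tau' *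
    (bloch_norm R d L * plane_wave R k i.1 * (tau == i.2)%:R *
    (bloch_norm R d L * (plane_wave R k j.1)^* * (tau' == j.2)%:R))).
  rewrite sum_lfunE sum_ffunE; apply: eq_bigr => tau _.
  rewrite sum_lfunE sum_ffunE; apply: eq_bigr => tau' _.
  rewrite (scale_comp_lfunE _ _ (bloch_annih_creat_vac k tau' j)) ffunE.
  by rewrite bloch_creat_vac_set1 /GRing.scale /= mulrAC -mulrA.
rewrite (bigD1 i.2) //= [X in _ + X]big1 ?addr0 => [|tau /negbTE ti]; last first.
  by rewrite ti big1 // => tau' _; rewrite mulr0 mul0r mulr0.
rewrite (bigD1 j.2) //= [X in _ + X]big1 ?addr0 => [|tau /negbTE tj]; last first.
  by rewrite tj !mulr0.
by rewrite !eqxx !mulr1.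
Qed.

Lemma bloch_mx_eigen (g : orb -> orb -> C) (a : C) H eps U k n :
    bloch_hamiltonian (quadratic g + a *: \1%VF) H -> diagonalizes H eps U ->
  let psi := col (enum_rank (k, n)) (bloch_mx U) in
  mode_mx g *m psi = (eps k n)%:C%C *: psi.
Proof.
move=> gH HU psi; apply/matrixP => b z; rewrite {}[z]ord1 !mxE sum_mode !enum_rankK.
set i := enum_val b => /=.
have HUk : H k *m U k = U k *m diag_mx (\row_m (eps k m)%:C%C).
  have [/unitarymxP/mulmx1C UU ->] := HU k.
  by rewrite -mulmxA UU mulmx1.
(* The sum over cells becomes a plane-wave overlap, which retains only [q = k]. Of the three factors
   [bloch_norm], two cancel the resulting [L ^ d]; the third belongs to [psi]. *)
transitivity (\sum_q \sum_sigma H q i.2 sigma * U k sigma n *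
    (bloch_norm R d L * bloch_norm R d L * bloch_norm R d L * plane_wave R q i.1 *
     \sum_y ((plane_wave R q y)^* * plane_wave R k y))).
  transitivity (\sum_(j : orb) \sum_q H q i.2 j.2 * U k j.2 n *
     (bloch_norm R d L * bloch_norm R d L * bloch_norm R d L * plane_wave R q i.1 *
     ((plane_wave R q j.1)^* * plane_wave R k j.1))).
    apply: eq_bigr => j _; rewrite !mxE !enum_rankK -/i (bloch_matrix_elements _ _ gH) /=.
    by rewrite mulr_suml; apply: eq_bigr => q _; ring.
  rewrite exchange_big; apply: eq_bigr => q _; rewrite sum_pair_mode exchange_big.
  by apply: eq_bigr => sigma _ /=; rewrite !mulr_sumr.
rewrite (bigD1 k) //= [X in _ + X]big1 ?addr0 => [|q qk]; last first.
  by rewrite big1 // => sigma _; rewrite plane_wave_orth // (negbTE qk) !mulr0.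
rewrite -mulr_suml plane_wave_orth // eqxx mulr1.
have /matrixP/(_ i.2 n) := HUk; rewrite mul_mx_diag !mxE => ->.
set u := U k _ _; set e := (eps k n)%:C%C; set p := plane_wave R k _.
rewrite -[RHS]mul1r -[X in _ = X * _]bloch_norm_sqr; ring.
Qed.

End Bloch.

(** * Support of local eigenvectors and the total one-body matrix *)

Section OccupiedSpace.
Variables (R : realType) (d L N : nat).
Local Notation C := R[i].
Local Notation cell := (lattice d L).
Local Notation orb := (mode d L N).

(** Since [e] is nonzero, each entry of [u] is a combination of entries in one column of [h x], and
    the columns of modes farther than [r] from [x] vanish. *)
Lemma supported_near_eigen r (h : cell -> orb -> orb -> C) x (u : 'rV[C]_#|{: orb}|) e :
    hermitian_terms h -> finite_range r h -> e != 0 ->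
    u *m mode_mx (h x) = e *: u ->
  supported_near r x (one_particle (u^t*)).
Proof.
move=> h_herm h_range e0 uh.
exists (fun y tau => (u 0 (enum_rank (y, tau)))^*).
  rewrite /one_particle creatvE /one_particle_state pair_big; apply: eq_bigr => -[y tau] _ /=.
  by rewrite !mxE.
move=> y tau; rewrite conjC_eq0; apply: contraR; rewrite -ltNge => y_far.
have /matrixP/(_ 0 (enum_rank (y, tau))) := uh; rewrite !mxE => /esym/eqP.
rewrite big1 => [|a _]; first by rewrite mulf_eq0 (negbTE e0).
rewrite mxE enum_rankK; case: (enum_val a) => y' tau'.
by rewrite h_range ?mulr0 //; right.
Qed.

Lemma mode_mx_sum (I : finType) (M : finType) (g : I -> M -> M -> C) :
  mode_mx (fun i j => \sum_x g x i j) = \sum_x mode_mx (g x).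
Proof.
by apply/matrixP => a b; rewrite summxE !mxE; apply: eq_bigr => x _; rewrite mxE.
Qed.

Lemma hamiltonianE (h : cell -> orb -> orb -> C) (c : cell -> R) :
  hamiltonian h c =
  quadratic (fun i j => \sum_x h x i j) + (\sum_x (c x)%:C%C) *: \1%VF.
Proof.
rewrite /hamiltonian big_split /=; congr (_ + _); last by rewrite -scaler_suml.
rewrite exchange_big; apply: eq_bigr => i _ /=; rewrite exchange_big.
by apply: eq_bigr => j _ /=; rewrite -scaler_suml.
Qed.

End OccupiedSpace.

(** * The two inclusions between the span of local states and the occupied space *)

Theorem mainTheorem3 (R : realType) (d N : nat) (r : R) (L : nat)
    (h : lattice d L -> mode d L N -> mode d L N -> R[i])
    (c : lattice d L -> R)
    (H Hplus Hminus : momentum d L -> 'M[R[i]]_N)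
    (omega : momentum d L -> 'I_N -> R)
    (eps : momentum d L -> 'I_N -> R) (U : momentum d L -> 'M[R[i]]_N) :
  (0 < L)%N ->
  hermitian_terms h ->
  finite_range r h ->
  translation_invariant (hamiltonian h c) ->
  bloch_hamiltonian (hamiltonian h c) H ->
  (forall k, posneg_parts (H k) (Hplus k) (Hminus k)) ->
  (forall k, ordered_eigenvalues (Hminus k) (omega k)) ->
  diagonalizes H eps U ->
  frustration_free h c ->
  (forall m : 'I_N, (exists k, omega k m != 0) -> forall k, omega k m < 0) ->
  exists ws : seq (Fock R (mode d L N)),
    (forall w, w \in ws -> exists x, supported_near r x w) /\
    <<ws>>%VS = occupied_space eps U.
Proof.
move=> L_gt0 h_herm h_range _ HH _ _ HU [E [E_min [Phi Phi0 ground]]] _.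
pose n := #|{: mode d L N}|.
have /fin_all_exists [K KP] : forall x, exists K : 'M[R[i]]_n * 'M[R[i]]_n,
  [/\ mode_mx (h x) = K.1^t* *m K.1 - K.2^t* *m K.2,
      forall i, exists2 e : R[i], 0 < e & row i K.1 *m mode_mx (h x) = e *: row i K.1
    & forall i, exists2 e : R[i], 0 < e & row i K.2 *m mode_mx (h x) = - e *: row i K.2].
  move=> x; have [|Kp [Km KP]] := @hermitian_split _ _ (mode_mx (h x)).
    by apply/matrixP => a b; rewrite !mxE -h_herm.
  by exists (Kp, Km).
pose Kp x := (K x).1; pose Km x := (K x).2.
(* Frustration-freeness enters here: [Phi] is a ground state of the terms at [x] and at [y]
   simultaneously. *)
have Kpm x y : Kp x *m (Km y)^t* = 0.
  apply/matrixP => i j; rewrite [RHS]mxE.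
  have [_ /(_ i)[e e0 Ke] _] := KP x; have [_ _ /(_ j)[e' e'0 Ke']] := KP y.
  have := common_ground_state_orth (E_min x) (E_min y) (ground x) (ground y) Phi0
    (h_herm y) Ke e0 Ke' e'0.
  by rewrite adjmx_row !mxE => {2}<-; apply: eq_bigr => a _; rewrite !mxE.
set g := mode_mx (fun i j => \sum_x h x i j).
pose Gp := \sum_x (Kp x)^t* *m Kp x; pose Gm := \sum_x (Km x)^t* *m Km x.
have gE : g = Gp - Gm.
  by rewrite /g mode_mx_sum -sumrB; apply: eq_bigr => x _; have [] := KP x.
have Gpm : Gp *m Gm = 0.
  rewrite mulmx_suml big1 // => x _; rewrite mulmx_sumr big1 // => y _.
  by rewrite mulmxA -[_ *m _ *m (Km y)^t*]mulmxA Kpm mulmx0 mul0mx.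
have Gmp : Gm *m Gp = 0.
  rewrite mulmx_suml big1 // => x _; rewrite mulmx_sumr big1 // => y _.
  rewrite mulmxA -[_ *m _ *m (Kp y)^t*]mulmxA.
  by rewrite -[Km x]trmxCK -adjmxM Kpm trmx0 map_mx0 mulmx0 mul0mx.
pose psi k m := col (enum_rank (k, m)) (bloch_mx U).
have g_psi k m : g *m psi k m = (eps k m)%:C%C *: psi k m.
  by move: HH; rewrite hamiltonianE => /(bloch_mx_eigen L_gt0 k m); apply.
(* As the cross term [Gp *m Gm] vanishes, [- g] meets the condition of [gram_ker], with eigenvalue
   [- eps k m] on [psi k m]. *)
have Kp_psi k m : eps k m < 0 -> forall x, Kp x *m psi k m = 0.
  move=> e0; apply: (@gram_ker _ _ _ _ (- g) _ (- (eps k m)%:C%C)).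
  - by rewrite -/Gp gE opprB mulmxBr Gpm sub0r.
  - by rewrite mulNmx g_psi scaleNr.
  - by rewrite oppr_ge0 ltW // -[0]/(0%:C%C) ltcR.
(* Zero modes are included: the local negative eigenvectors have to be orthogonal to them as
   well. *)
have Km_psi k m : 0 <= eps k m -> forall x, Km x *m psi k m = 0.
  move=> e0; apply: (@gram_ker _ _ _ _ g _ ((eps k m)%:C%C)) => //.
  - by rewrite -/Gm gE mulmxBr Gmp sub0r.
  - by rewrite -[0]/(0%:C%C) lecR.
(* The rows of every [Km x] are left eigenvectors, so their adjoints are the wave functions; zero
   rows contribute only the zero vector. *)
pose w (p : lattice d L * 'I_n) := one_particle ((row p.2 (Km p.1))^t*).
exists (map w (enum predT)); split.
  move=> _ /mapP [[x i] _ ->]; exists x; rewrite /w /=.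
  have [_ _ /(_ i) [e e0 Ke]] := KP x.
  by apply: (supported_near_eigen h_herm h_range _ Ke); rewrite oppr_eq0 gt_eqF.
apply/subv_anti/andP; split.
- apply/span_subvP => _ /mapP [[x i] _ ->]; rewrite /w /=.
  set u := _^t*; pose W := bloch_mx U.
  (* First inclusion: expand [u] in the orthonormal Bloch basis and show that only negative energies
     occur. *)
  have {1}-> : u = \sum_b (W^t* *m u) b 0 *: col b W.
    have /mulmx1C WW := bloch_mx_unitary L_gt0 (fun k => (HU k).1).
    rewrite -[LHS]mul1mx -WW -mulmxA.
    apply/matrixP => a z; rewrite ord1 mxE summxE; apply: eq_bigr => b _.
    by rewrite mulrC !mxE.
  rewrite linear_sum; apply: memv_suml => b _; rewrite linearZ /=.
  rewrite -[b]enum_valK; case: (enum_val b) => k m.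
  case: (ltrP (eps k m) 0) => e0.
    apply: memvZ; apply/(subvP (sumv_sup k _ (subvv _))) => //.
    apply/(subvP (sumv_sup m _ (subvv _))) => //.
    by rewrite band_creat_vac memv_line.
  suff -> : (W^t* *m u) (enum_rank (k, m)) 0 = 0 by rewrite scale0r mem0v.
  (* Because [u] is the adjoint of row [i] of [Km x], its overlap with [psi k m] is a conjugated
     entry of [Km x *m psi k m]. *)
  transitivity (((Km x *m psi k m) i 0)^*); last first.
    rewrite Km_psi // mxE; exact: conjC0.
  rewrite !mxE rmorph_sum; apply: eq_bigr => a _.
  by rewrite [RHS]rmorphM mulrC; congr (_ * _); rewrite !mxE.
- apply/subv_sumP => k _; apply/subv_sumP => m em; rewrite -memvE.
  rewrite band_creat_vac -/(psi k m).
  have e0 : (eps k m)%:C%C != 0 by rewrite fmorph_eq0 lt_eqF.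
  (* Second inclusion: [Gp] kills [psi k m], so [eps k m] times [psi k m] equals [- Gm *m psi k m],
     a combination of adjoint rows of the [Km x]; divide by [eps k m]. *)
  have -> : psi k m = - (eps k m)%:C%C^-1 *: \sum_x \sum_i (Km x *m psi k m) i 0 *: (row i (Km x))^t*.
    apply: (scalerI e0); rewrite -g_psi scalerA mulrN divff // scaleN1r.
    rewrite gE mulmxBl mulmx_suml big1 => [|x _].
      rewrite sub0r mulmx_suml; congr (- _); apply: eq_bigr => x _.
      rewrite -mulmxA; apply/matrixP => a z; rewrite ord1 mxE summxE.
      by apply: eq_bigr => i _; rewrite mulrC !mxE.
    by rewrite -mulmxA Kp_psi ?mulmx0.
  rewrite linearZ memvZ //= linear_sum memv_suml // => x _.
  rewrite linear_sum memv_suml // => i _; rewrite linearZ memvZ //=.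
  by apply: memv_span; apply/mapP; exists (x, i); rewrite ?mem_enum.
Qed.
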